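(* Let $\{(x^k,z^k,\pi^k,\xi^k,\varphi_k)\}_{k\ge0}$ be generated by the Master Algorithm described in the context, applied to the inequality-constrained convex quadratic program $(P)$: $\min\{f(x):Ax\ge b\}$, under the standing assumptions, with a base iteration and a penalty-parameter update satisfying the requirements listed in the context. Then (i) $\varphi_k$ is eventually constant, and (ii) as $k\to\infty$, $z^k\to0$ and $x^k$ converges to the optimal solution set of $(P)$ (i.e., the distance from $x^k$ to that set tends to $0$).
   Context: Problem (no equality constraints). $n,m\ge1$; $H\in\mathbb R^{n\times n}$ symmetric positive semidefinite, $c\in\mathbb R^n$, $A\in\mathbb R^{m\times n}$, $b\in\mathbb R^m$; $f(x)=\frac12x^THx+c^Tx$. Inequalities between vectors are componentwise; $\mathbf 1$ is the all-ones vector; $\|\cdot\|$ is an arbitrary norm; for a vector $v$, the capital letter $V$ denotes $\mathrm{diag}(v)$. $(P)$: minimize $f(x)$ subject to $Ax\ge b$. Its dual $(D)$: maximize $\psi(x,\pi)=-\frac12x^THx+b^T\pi$ subject to $Hx+c-A^T\pi=0$, $\pi\ge0$. Standing assumptions. (1) There is $x$ with $Ax>b$; there is $(x,\pi)$ with $Hx+c-A^T\pi=0$, $\pi>0$; and the (nonempty) optimal solution set of $(P)$ is bounded. (2) $[H;A]$ has full column rank. Augmented problem. For $\varphi>0$, $(P_\varphi)$: minimize $f_\varphi(x,z):=f(x)+\varphi\mathbf 1^Tz$ over $(x,z)\in\mathbb R^n\times\mathbb R^m$ subject to $Ax+z\ge b$, $z\ge0$. This is an inequality-constrained CQP in $(x,z)$;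 multipliers of the two groups of constraints are denoted $\pi,\xi$ respectively. Base iteration. A procedure (possibly with internal state) which, applied repeatedly to an inequality-constrained CQP ''minimize $q(u)=\frac12u^TQu+g^Tu$ s.t. $Mu\ge h$'' ($Q$ symmetric positive semidefinite), produces a primal sequence $\{u^\ell\}_{\ell\ge0}$ with an associated dual sequence $\{\lambda^\ell\}$, $\lambda^\ell\ge0$, such that: (BI1) at least one of the following holds: (i) $u^{\ell+1}$ is feasible whenever $u^\ell$ is feasible; (ii) $u^{\ell+1}$ is strictly feasible ($Mu^{\ell+1}>h$) whenever $u^\ell$ is strictly feasible; (BI2) for every $\ell_0\ge0$ there is $\ell>\ell_0$ with $q(u^\ell)\le q(u^{\ell_0})$; (BI3) with $\hat K:=\{k>0: q(u^k)\le q(u^\ell)\ \forall \ell<k\}$ (an infinite set), if $\{u^k\}_{k\in\hat K}$ is bounded then $\max\{\|\mathrm{diag}(Mu^k-h)\lambda^k\|,\|Qu^k+g-M^T\lambda^k\|\}\to0$ as $k\to\infty$, $k\in\hat K$. Master Algorithm. Initialization: $x^0,z^0$ with $z^0>0$, $Ax^0+z^0>b$ (non-strict inequalities are allowed if (BI1)(i) holds), $(\pi^0,\xi^0)\ge0$, $\varphi_0>0$. Iteration $k=0,1,2,\dots$: the penalty-parameter update, from $\varphi_k,x^k,z^k,\pi^k,\xi^k$, returns $\varphi_{k+1}\ge\varphi_k$; then the base iteration is applied to $(P_{\varphi_{k+1}})$ from $(x^k,z^k)$, repeatedly, until it returns a point whose $f_{\varphi_{k+1}}$-value is at most $f_{\varphi_{k+1}}(x^k,z^k)$;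 this point is $(x^{k+1},z^{k+1})$ and its associated dual vector is $(\pi^{k+1},\xi^{k+1})\ge0$. As long as the penalty parameter stays constant, the successive base iterates form a single run of the base iteration on that augmented problem. No stopping criterion is used, so the sequences are infinite; in particular $f_{\varphi_k}(x^k,z^k)\le f_{\varphi_k}(x^{k-1},z^{k-1})$ for all $k\ge1$. Slack: $s^k=Ax^k+z^k-b$. Requirements on the penalty-parameter update. (PU1) $\{\varphi_k\}$ is positive, nondecreasing, and either eventually constant or grows without bound. (PU2) If $\{z^k\}$ is unbounded then $\varphi_k\to\infty$. (PU3) If $\varphi_k$ is eventually constant, equal to $\hat\varphi$, and $S^k\pi^k$, $Z^k\xi^k$, $Hx^k+c-A^T\pi^k$, $\pi^k+\xi^k-\varphi_k\mathbf 1$ and $(Hx^k+c-A^T\pi^k)^Tx^k$ all tend to $0$, then $\hat\varphi>\liminf_k\|\pi^k\|_\infty$. (PU4) If $\{z^k\}$ is bounded but $\varphi_k\to\infty$, then there is an infinite index set $K$ on which $S^k\pi^k$, $Z^k\xi^k$, $Hx^k+c-A^T\pi^k$, $\pi^k+\xi^k-\varphi_k\mathbf 1$, $(Hx^k+c-A^T\pi^k)^Tx^k$ and $\varphi_k/\max\{1,\|\pi^k\|\}$ are bounded. *)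

(* Defs.v *)
From HB Require Import structures.
From mathcomp Require Import all_boot all_order all_algebra.
From mathcomp Require Import all_classical all_reals all_analysis.

Set Implicit Arguments.
Unset Strict Implicit.
Unset Printing Implicit Defensive.

Import Order.TTheory GRing.Theory Num.Theory.
Import numFieldNormedType.Exports.

Local Open Scope classical_set_scope.
Local Open Scope ring_scope.

Section Vectors.
Context {R : realType}.

Definition dot d (u v : 'cV[R]_d) : R := (u^T *m v) 0 0.

Definition vle d (u v : 'cV[R]_d) : Prop := forall i, u i 0 <= v i 0.
Definition vlt d (u v : 'cV[R]_d) : Prop := forall i, u i 0 < v i 0.

Definition diagv d (v : 'cV[R]_d) : 'M[R]_d := diag_mx v^T.

Definition sym_psd d (Q : 'M[R]_d) : Prop :=
  Q^T = Q /\ forall u : 'cV[R]_d, 0 <= dot u (Q *m u).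

(* An arbitrary norm on column vectors, one for each dimension. The library
   norm `|v| on 'cV[R]_d is the infinity norm; convergence and boundedness of
   vectors are the library's, which do not depend on the choice of norm. *)
Record is_norm (N : forall d, 'cV[R]_d -> R) : Prop := IsNorm {
  norm_triangle : forall d (u v : 'cV[R]_d), N d (u + v) <= N d u + N d v;
  norm_scale : forall d (a : R) (u : 'cV[R]_d), N d (a *: u) = `|a| * N d u;
  norm_definite : forall d (u : 'cV[R]_d), N d u = 0 -> u = 0 }.

Definition dist (N : forall d, 'cV[R]_d -> R) d (u : 'cV[R]_d)
    (S : set 'cV[R]_d) : R :=
  inf [set N d (u - v) | v in S].

End Vectors.

Definition eventually_constant (R : realType) (phi : nat -> R) : Prop :=
  exists a, \forall k \near \oo, phi k = a.

(* minimize (1/2) u^T Q u + g^T u subject to M u >= h *)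
Record cqp (R : realType) (p q : nat) := CQP {
  cqpQ : 'M[R]_p; cqpg : 'cV[R]_p; cqpM : 'M[R]_(q, p); cqph : 'cV[R]_q }.

Section CQP.
Context {R : realType} {p q : nat}.
Implicit Types (Pb : cqp R p q) (u : 'cV[R]_p) (l : 'cV[R]_q).

Definition objective Pb u : R :=
  2^-1 * dot u (cqpQ Pb *m u) + dot (cqpg Pb) u.

Definition feasible Pb u : Prop := vle (cqph Pb) (cqpM Pb *m u).
Definition strictly_feasible Pb u : Prop := vlt (cqph Pb) (cqpM Pb *m u).

Definition optimal_set Pb : set 'cV[R]_p :=
  [set u | feasible Pb u /\
     forall v, feasible Pb v -> objective Pb u <= objective Pb v].

Definition kkt_residual (N : forall d, 'cV[R]_d -> R) Pb u l : R :=
  Num.max (N q (diagv (cqpM Pb *m u - cqph Pb) *m l))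
          (N p (cqpQ Pb *m u + cqpg Pb - (cqpM Pb)^T *m l)).

End CQP.

(* f(x) + phi 1^T z subject to A x + z >= b and z >= 0, in the stacked
   variable col_mx x z, with stacked multiplier col_mx pi xi. *)
Definition augmented (R : realType) n m (Pb : cqp R n m) (phi : R) :
    cqp R (n + m) (m + m) :=
  CQP (block_mx (cqpQ Pb) 0 0 0)
      (col_mx (cqpg Pb) (const_mx phi))
      (block_mx (cqpM Pb) 1%:M 0 1%:M)
      (col_mx (cqph Pb) 0).

Section StandingAssumptions.
Context {R : realType} {n m : nat}.
Variables (H : 'M[R]_n) (c : 'cV[R]_n) (A : 'M[R]_(m, n)) (b : 'cV[R]_m).

Record standing_assumptions : Prop := StandingAssumptions {
  primal_strict : exists x, vlt b (A *m x);
  dual_strict : exists x pi, H *m x + c - A^T *m pi = 0 /\ vlt 0 pi;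
  optimal_nonempty : optimal_set (CQP H c A b) !=set0;
  optimal_bounded : bounded_set (optimal_set (CQP H c A b));
  full_column_rank : \rank (col_mx H A) = n }.

End StandingAssumptions.

(* A procedure acting on an internal state, which exposes the current primal
   point and its associated dual vector. [bi_init Pb s] says that the procedure
   may be started on Pb from s. The state is arbitrary, so it can also hold
   initial multipliers, parameters, or a source of nondeterminism. *)
Record base_iteration (R : realType) := BaseIteration {
  bi_state : nat -> nat -> Type;
  bi_init : forall p q, cqp R p q -> bi_state p q -> Prop;
  bi_step : forall p q, cqp R p q -> bi_state p q -> bi_state p q;
  bi_primal : forall p q, bi_state p q -> 'cV[R]_p;
  bi_dual : forall p q, bi_state p q -> 'cV[R]_q }.

Section BaseIteration.
Context {R : realType}.
Variable B : base_iteration R.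

Definition bi_run p q (Pb : cqp R p q) (s0 : bi_state B p q) (l : nat) :
  bi_state B p q := iter l (bi_step Pb) s0.

Definition primal_seq p q (Pb : cqp R p q) (s0 : bi_state B p q) (l : nat) :=
  bi_primal (bi_run Pb s0 l).
Definition dual_seq p q (Pb : cqp R p q) (s0 : bi_state B p q) (l : nat) :=
  bi_dual (bi_run Pb s0 l).

Definition proper_start p q (Pb : cqp R p q) (s0 : bi_state B p q) : Prop :=
  sym_psd (cqpQ Pb) /\ bi_init Pb s0.

Definition BI1i : Prop :=
  forall p q (Pb : cqp R p q) s0, proper_start Pb s0 ->
  forall l, feasible Pb (primal_seq Pb s0 l) ->
    feasible Pb (primal_seq Pb s0 l.+1).

Definition BI1ii : Prop :=
  forall p q (Pb : cqp R p q) s0, proper_start Pb s0 ->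
  forall l, strictly_feasible Pb (primal_seq Pb s0 l) ->
    strictly_feasible Pb (primal_seq Pb s0 l.+1).

Definition BI2 : Prop :=
  forall p q (Pb : cqp R p q) s0, proper_start Pb s0 ->
  forall l0 : nat, exists l, (l0 < l)%N /\
    objective Pb (primal_seq Pb s0 l) <= objective Pb (primal_seq Pb s0 l0).

Definition record_indices p q (Pb : cqp R p q) (u : nat -> 'cV[R]_p) :
    set nat :=
  [set k | (0 < k)%N /\
     forall l, (l < k)%N -> objective Pb (u k) <= objective Pb (u l)].

Definition BI3 (N : forall d, 'cV[R]_d -> R) : Prop :=
  forall p q (Pb : cqp R p q) s0, proper_start Pb s0 ->
  let u := primal_seq Pb s0 in
  let K := record_indices Pb u in
  [bounded u k | k in K] ->
  kkt_residual N Pb (u k) (dual_seq Pb s0 k) @[k --> within K \oo] --> (0 : R).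

Record base_iteration_requirements (N : forall d, 'cV[R]_d -> R) : Prop :=
  BaseIterationRequirements {
    bi_dual_ge0 : forall p q (Pb : cqp R p q) s0, proper_start Pb s0 ->
      forall l, vle 0 (dual_seq Pb s0 l);
    bi_1 : BI1i \/ BI1ii;
    bi_2 : BI2;
    bi_3 : BI3 N }.

End BaseIteration.

Section MasterAlgorithm.
Context {R : realType} {n m : nat}.
Variables (H : 'M[R]_n) (c : 'cV[R]_n) (A : 'M[R]_(m, n)) (b : 'cV[R]_m).
Variables (x : nat -> 'cV[R]_n) (z pi xi : nat -> 'cV[R]_m) (phi : nat -> R).

Let Paug (a : R) := augmented (CQP H c A b) a.
Let w (k : nat) : 'cV[R]_(n + m) := col_mx (x k) (z k).

(* [s k] is the state of the base iteration at the beginning of iteration k,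
   and [t k] the number of base iterations performed during iteration k. *)
Record master_iterations (B : base_iteration R)
    (update : R -> 'cV[R]_n -> 'cV[R]_m -> 'cV[R]_m -> 'cV[R]_m -> R)
    (s : nat -> bi_state B (n + m) (m + m)) (t : nat -> nat) : Prop :=
  MasterIterations {
    master_start :
      (vlt 0 (z 0%N) /\ vlt b (A *m x 0%N + z 0%N)) \/
      [/\ BI1i B, vle 0 (z 0%N) & vle b (A *m x 0%N + z 0%N)];
    master_dual_start : vle 0 (pi 0%N) /\ vle 0 (xi 0%N);
    master_phi_start : 0 < phi 0%N;
    master_update : forall k,
      phi k.+1 = update (phi k) (x k) (z k) (pi k) (xi k);
    master_update_ge : forall k, phi k <= phi k.+1;
    master_state : forall k, bi_primal (s k) = w k;
    master_first_run : bi_init (Paug (phi 1%N)) (s 0%N);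
    master_new_run : forall k, phi k.+2 != phi k.+1 ->
      bi_init (Paug (phi k.+2)) (s k.+1);
    master_same_run : forall k, phi k.+2 = phi k.+1 ->
      s k.+1 = bi_run (Paug (phi k.+1)) (s k) (t k);
    master_count_gt0 : forall k, (0 < t k)%N;
    master_return : forall k,
      objective (Paug (phi k.+1)) (primal_seq (Paug (phi k.+1)) (s k) (t k))
        <= objective (Paug (phi k.+1)) (w k);
    master_no_return : forall k l, (0 < l < t k)%N ->
      objective (Paug (phi k.+1)) (w k)
        < objective (Paug (phi k.+1)) (primal_seq (Paug (phi k.+1)) (s k) l);
    master_next_primal : forall k,
      w k.+1 = primal_seq (Paug (phi k.+1)) (s k) (t k);
    master_next_dual : forall k,
      col_mx (pi k.+1) (xi k.+1) = dual_seq (Paug (phi k.+1)) (s k) (t k) }.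

Definition generated_by_master (B : base_iteration R)
    (update : R -> 'cV[R]_n -> 'cV[R]_m -> 'cV[R]_m -> 'cV[R]_m -> R) : Prop :=
  exists s t, master_iterations (B := B) update s t.

Definition slack (k : nat) : 'cV[R]_m := A *m x k + z k - b.
Definition dual_residual (k : nat) : 'cV[R]_n :=
  H *m x k + c - A^T *m pi k.

Definition PU1 : Prop :=
  [/\ forall k, 0 < phi k,
      forall k, phi k <= phi k.+1 &
      eventually_constant phi \/ phi @ \oo --> +oo].

Definition PU2 : Prop := ~ bounded_fun z -> phi @ \oo --> +oo.

Definition PU3 : Prop :=
  forall phihat : R, (\forall k \near \oo, phi k = phihat) ->
  diagv (slack k) *m pi k @[k --> \oo] --> (0 : 'cV[R]_m) ->
  diagv (z k) *m xi k @[k --> \oo] --> (0 : 'cV[R]_m) ->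
  dual_residual k @[k --> \oo] --> (0 : 'cV[R]_n) ->
  pi k + xi k - const_mx (phi k) @[k --> \oo] --> (0 : 'cV[R]_m) ->
  dot (dual_residual k) (x k) @[k --> \oo] --> (0 : R) ->
  (limn_einf (fun k => `|pi k|%:E) < phihat%:E)%E.

Definition PU4 (N : forall d, 'cV[R]_d -> R) : Prop :=
  bounded_fun z -> phi @ \oo --> +oo ->
  exists K : set nat, infinite_set K /\
  [/\ [bounded diagv (slack k) *m pi k | k in K],
      [bounded diagv (z k) *m xi k | k in K] &
      [bounded dual_residual k | k in K]] /\
  [/\ [bounded pi k + xi k - const_mx (phi k) | k in K],
      [bounded dot (dual_residual k) (x k) | k in K] &
      [bounded phi k / Num.max 1 (N m (pi k)) | k in K]].

Record penalty_update_requirements (N : forall d, 'cV[R]_d -> R) : Prop :=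
  PenaltyUpdateRequirements {
    pu_1 : PU1;
    pu_2 : PU2;
    pu_3 : PU3;
    pu_4 : PU4 N }.

End MasterAlgorithm.

(* Main.v *)
Require Import Defs.
From HB Require Import structures.
From mathcomp Require Import all_boot all_order all_algebra.
From mathcomp Require Import all_classical all_reals all_analysis.
From mathcomp Require Import zify ring lra.

Set Implicit Arguments.
Unset Strict Implicit.
Unset Printing Implicit Defensive.

Import Order.TTheory GRing.Theory Num.Theory.
Import numFieldNormedType.Exports.

Local Open Scope classical_set_scope.
Local Open Scope ring_scope.

(** Write f_a(x,z) = f(x) + a 1^T z. Everything rests on one computation,
[lagrangian_identity]: comparing two points (x,z) and (y,v) through a multiplier
pi >= 0 yields, for any (y,v) with A y + v >= b,
  f(y) + pi^T v >= f(x) + r^T (y - x) - pi^T s + pi^T z,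
where r is the dual residual and s the slack at (x,z). It is used with four
choices of (y,v) and pi.

A strictly feasible dual point in the role of (x,pi) gives a lower bound
f(y) + a 1^T v >= C on the relaxed feasible set; the nonnegative terms dropped
from the identity then also bound the sublevel sets with v bounded
([augmented_level_bounded]), since H y and A y are controlled there and [H;A]
has a left inverse.

The penalty cannot diverge. If it did, (f + a 1^T z - C) / (phi_k - a) + 1^T z
would eventually be nonincreasing along the iterates, whence z is bounded
([violations_bounded]). If y is strictly feasible, v = - eta 1 is allowed for
a small eta > 0, and the bound above reads eta 1^T pi^k <= constant along the
index set K of the update requirement, as r, r^T x and S pi are bounded there;
but the same requirement makes |pi^k| grow at least like phi_k along K
([penalty_not_diverging]).

So phi_k is eventually a constant a. The iterates after the start of the last
run are exactly the record points of the base iteration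
([constant_penalty_residual]), are bounded, and hence have vanishing residual.
The update rule then supplies
infinitely many k with |pi^k| <= a - delta. For those, xi^k is bounded away from
0, so complementarity forces z^k -> 0, and the bound with (y,v) an arbitrary
relaxed point becomes an approximate exact-penalty inequality
  f_a(x^k,z^k) + delta 1^T v <= f_a(y,v) + o(1)
([penalized_bound_frequently]). Since f_a decreases along the iterates and is
bounded below, (y,v) = (x^j,z^j) gives z^j -> 0 for the whole sequence, and
(y,v) = (xs,0) with xs optimal gives limsup f(x^j) <= f(xs). A compactness
argument turns this into convergence to the optimal set
([dist_optimal_cvg0]). *)

(** * Inner products and the max norm *)

Section Dot.
Context {R : realType}.

Lemma dotE d (u v : 'cV[R]_d) : dot u v = \sum_i u i 0 * v i 0.
Proof. by rewrite /dot mxE; apply: eq_bigr => i _; rewrite mxE. Qed.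

Lemma dotC d (u v : 'cV[R]_d) : dot u v = dot v u.
Proof. by rewrite !dotE; apply: eq_bigr => i _; rewrite mulrC. Qed.

Lemma dotDr d (u v w : 'cV[R]_d) : dot u (v + w) = dot u v + dot u w.
Proof. by rewrite /dot mulmxDr mxE. Qed.

Lemma dotNr d (u v : 'cV[R]_d) : dot u (- v) = - dot u v.
Proof. by rewrite /dot mulmxN mxE. Qed.

Lemma dotDl d (u v w : 'cV[R]_d) : dot (u + v) w = dot u w + dot v w.
Proof. by rewrite dotC dotDr !(dotC w). Qed.

Lemma dotNl d (u v : 'cV[R]_d) : dot (- u) v = - dot u v.
Proof. by rewrite dotC dotNr dotC. Qed.

Definition dot_linear := (@dotDr, @dotNr, @dotDl, @dotNl).

Lemma dot_trmx p q (A : 'M[R]_(q, p)) (u : 'cV_q) (v : 'cV_p) :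
  dot (A^T *m u) v = dot u (A *m v).
Proof. by rewrite /dot trmx_mul trmxK mulmxA. Qed.

Lemma dot_ge0 d (u v : 'cV[R]_d) : vle 0 u -> vle 0 v -> 0 <= dot u v.
Proof.
move=> u0 v0; rewrite dotE; apply: sumr_ge0 => i _.
by apply: mulr_ge0; [have := u0 i | have := v0 i]; rewrite mxE.
Qed.

Lemma vle_sub_ge0 d (u v : 'cV[R]_d) : vle u v -> vle 0 (v - u).
Proof. by move=> uv i; rewrite [X in X <= _]mxE 2!mxE subr_ge0. Qed.

Lemma vlt0_uniform d (p : 'cV[R]_d) : vlt 0 p ->
  exists2 e, 0 < e & forall i, e <= p i 0.
Proof.
move=> p0; have p0' i : 0 < p i 0 by have := p0 i; rewrite mxE.
exists (\big[Num.min/1]_i p i 0) => [|i]; first exact: lt_bigmin.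
exact: bigmin_le_cond.
Qed.

Lemma diagv_mulE d (u v : 'cV[R]_d) i : (diagv u *m v) i 0 = u i 0 * v i 0.
Proof. by rewrite /diagv mul_diag_mx !mxE. Qed.

Lemma dot_diagv d (u v : 'cV[R]_d) : dot v u = \sum_i (diagv u *m v) i 0.
Proof. by rewrite dotE; apply: eq_bigr => i _; rewrite diagv_mulE mulrC. Qed.

End Dot.

Section MaxNorm.
Context {R : realType}.

Lemma small_multiple (C e : R) : 0 <= C -> 0 < e ->
  exists2 d, 0 < d & forall r, r < d -> C * r <= e.
Proof.
move=> C0 e0; have C1 : 0 < C + 1 by rewrite ltr_wpDl.
exists (e / (C + 1)) => [|r]; first exact: divr_gt0.
rewrite ltr_pdivlMr// mulrDr mulr1 => re.
have [r0|/ltW r0] := leP 0 r; first by rewrite mulrC; lra.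
by rewrite (le_trans _ (ltW e0))// mulr_ge0_le0.
Qed.

Lemma coord_le_norm p q (A : 'M[R]_(p, q)) i j : `|A i j| <= `|A|.
Proof.
rewrite [leRHS]/Num.norm /= mx_normrE.
by apply/bigmax_geP; right; exists (i, j).
Qed.

Lemma mx_norm_le p q (A : 'M[R]_(p, q)) e :
  0 <= e -> (forall i j, `|A i j| <= e) -> `|A| <= e.
Proof.
move=> e0 Ae; rewrite [leLHS]/Num.norm /= mx_normrE.
by apply/bigmax_leP; split => // -[i j] _; exact: Ae.
Qed.

Lemma cV_norm_le d (v : 'cV[R]_d) e :
  0 <= e -> (forall i, `|v i 0| <= e) -> `|v| <= e.
Proof. by move=> e0 ve; apply: mx_norm_le => // i j; rewrite ord1. Qed.

Lemma norm_mulmx p q r (A : 'M[R]_(p, q)) (B : 'M[R]_(q, r)) :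
  `|A *m B| <= q%:R * `|A| * `|B|.
Proof.
apply: mx_norm_le => [|i j]; first by rewrite mulr_ge0 ?mulr_ge0.
rewrite mxE (le_trans (ler_norm_sum _ _ _))//.
apply: (@le_trans _ _ (\sum_(k < q) `|A| * `|B|)).
  by apply: ler_sum => k _; rewrite normrM ler_pM ?coord_le_norm.
by rewrite sumr_const card_ord -mulrA mulr_natl.
Qed.

Lemma norm_dot d (u v : 'cV[R]_d) : `|dot u v| <= d%:R * `|u| * `|v|.
Proof.
rewrite dotE (le_trans (ler_norm_sum _ _ _))//.
apply: (@le_trans _ _ (\sum_(k < d) `|u| * `|v|)).
  by apply: ler_sum => k _; rewrite normrM ler_pM ?coord_le_norm.
by rewrite sumr_const card_ord -mulrA mulr_natl.
Qed.

Lemma norm_sum_coord d (v : 'cV[R]_d) : `|\sum_i v i 0| <= d%:R * `|v|.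
Proof.
rewrite (le_trans (ler_norm_sum _ _ _))//.
apply: (@le_trans _ _ (\sum_(k < d) `|v|)).
  by apply: ler_sum => k _; rewrite coord_le_norm.
by rewrite sumr_const card_ord mulr_natl.
Qed.

Lemma sum_vle0 d (v : 'cV[R]_d) : vle 0 v -> 0 <= \sum_i v i 0.
Proof. by move=> v0; apply: sumr_ge0 => i _; have := v0 i; rewrite mxE. Qed.

Lemma norm_le_sum d (v : 'cV[R]_d) : vle 0 v -> `|v| <= \sum_i v i 0.
Proof.
move=> v0; have v0' i : 0 <= v i 0 by have := v0 i; rewrite mxE.
apply: cV_norm_le => [|i]; first exact: sumr_ge0.
by rewrite ger0_norm// (bigD1 i)//= lerDl sumr_ge0.
Qed.

Lemma norm_col_mx_le p q (u : 'cV[R]_p) (v : 'cV[R]_q) e :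
  `|u| <= e -> `|v| <= e -> `|col_mx u v| <= e.
Proof.
move=> ue ve; apply: cV_norm_le => [|i]; first exact: le_trans ue.
rewrite mxE; case: splitP => j _.
  exact: le_trans (coord_le_norm _ _ _) ue.
exact: le_trans (coord_le_norm _ _ _) ve.
Qed.

Lemma norm_usub_le p q (u : 'cV[R]_p) (v : 'cV[R]_q) : `|u| <= `|col_mx u v|.
Proof.
by apply: cV_norm_le => // i; rewrite -(col_mxEu u v) coord_le_norm.
Qed.

Lemma norm_dsub_le p q (u : 'cV[R]_p) (v : 'cV[R]_q) : `|v| <= `|col_mx u v|.
Proof.
by apply: cV_norm_le => // i; rewrite -(col_mxEd u v) coord_le_norm.
Qed.

(** The form of sequential compactness used below: a point that a bounded
sequence approaches at arbitrarily late indices. *)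
Lemma bounded_cluster d (v : nat -> 'cV[R]_d) M : (forall k, `|v k| <= M) ->
  exists l, forall e, 0 < e ->
    forall k0, exists2 k, (k0 <= k)%N & `|v k - l| < e.
Proof.
move=> vM.
have cA : compact [set a : 'rV[R]_d | forall i, `[(- M), M]%classic (a ord0 i)].
  apply: (@rV_compact _ d (fun=> `[(- M), M]%classic)) => _.
  exact: segment_compact.
have [|l [_ cl]] := cA ((fun k => (v k)^T) @ \oo) _.
  exists 0%N => // k _ i; rewrite /= mxE in_itv/= -ler_norml.
  exact: le_trans (coord_le_norm _ _ _) (vM k).
exists l^T => e e0 k0.
have /(_ (ball l e)) := cl ((fun k => (v k)^T) @` [set k | (k0 <= k)%N]).
case.
- by exists k0 => // k /= kk; exists k.
- exact: nbhsx_ballx.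
- move=> _ [[k /= kk <-]]; rewrite -ball_normE /= => lk; exists k => //.
  rewrite distrC; apply: le_lt_trans lk; apply: cV_norm_le => // i.
  by have := coord_le_norm (l - (v k)^T) 0 i; rewrite !mxE.
Qed.

End MaxNorm.

(** * Arbitrary norms *)

Section Norms.
Context {R : realType} (N : forall d, 'cV[R]_d -> R) (N_norm : is_norm N).

Lemma is_norm0 d : N (0 : 'cV[R]_d) = 0.
Proof. by rewrite -(scale0r 0) (norm_scale N_norm) normr0 mul0r. Qed.

Lemma is_normN d (u : 'cV[R]_d) : N (- u) = N u.
Proof. by rewrite -scaleN1r (norm_scale N_norm) normrN normr1 mul1r. Qed.

Lemma is_norm_ge0 d (u : 'cV[R]_d) : 0 <= N u.
Proof.
have := norm_triangle N_norm u (- u).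
by rewrite subrr is_norm0 is_normN -mulr2n pmulrn_lge0.
Qed.

Lemma is_norm_le_max d : exists2 C, 0 <= C &
  forall u : 'cV[R]_d, N u <= C * `|u|.
Proof.
exists (\sum_(i < d) N (delta_mx i 0 : 'cV[R]_d)) => [|u].
  by apply: sumr_ge0 => i _; exact: is_norm_ge0.
have Nsum (F : 'I_d -> 'cV[R]_d) : N (\sum_i F i) <= \sum_i N (F i).
  elim/big_ind2 : _ => [|a a' b b' aa bb|//]; first by rewrite is_norm0.
  exact: le_trans (norm_triangle N_norm _ _) (lerD aa bb).
rewrite {1}[u]matrix_sum_delta.
under eq_bigr do rewrite big_ord1.
rewrite (le_trans (Nsum _))// mulr_suml; apply: ler_sum => i _.
rewrite (norm_scale N_norm) mulrC ler_wpM2l ?is_norm_ge0//.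
exact: coord_le_norm.
Qed.

(** Otherwise there are vectors of max norm 1 on which N tends to 0; a cluster
point of them still has max norm 1, but N vanishes there. *)
Lemma max_le_is_norm d : exists2 C, 0 <= C &
  forall u : 'cV[R]_d, `|u| <= C * N u.
Proof.
apply: contrapT => noC.
have bad (k : nat) : exists v : 'cV[R]_d, `|v| = 1 /\ k.+1%:R * N v <= 1.
  apply: contrapT => nov; apply: noC; exists k.+1%:R => // u.
  have [->|u0] := eqVneq u 0; first by rewrite normr0 mulr_ge0 ?is_norm_ge0.
  rewrite leNgt; apply/negP => uk; apply: nov.
  have nu0 : 0 < `|u| by rewrite normr_gt0.
  exists (`|u|^-1 *: u); split.
    by rewrite normrZ normfV normr_id mulVf ?gt_eqF.
  rewrite (norm_scale N_norm) normfV normr_id mulrCA ler_pdivrMl// mulr1.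
  exact: ltW.
have [v vP] := choice bad.
have [|l lP] := @bounded_cluster R d v 1; first by move=> k; rewrite (vP k).1.
have [C C0 NC] := is_norm_le_max d.
have Nl0 : N l = 0.
  apply/eqP; rewrite eq_le is_norm_ge0 andbT; apply/ler_addgt0Pr => e e0.
  have [r r0 rP] := small_multiple C0 (divr_gt0 e0 (ltr0Sn R 1)).
  have [k0 k0P] : exists k0 : nat, (2 / e) <= k0.+1%:R.
    exists (Num.bound (2 / e)); rewrite ltW//.
    apply: lt_trans (archi_boundP _) _; first by rewrite ltW ?divr_gt0.
    by rewrite ltr_nat.
  have [k kk vl] := lP _ r0 k0.
  have -> : l = v k + - (v k - l) by rewrite opprB addrC subrK.
  rewrite (le_trans (norm_triangle N_norm _ _))// is_normN add0r.
  rewrite [leRHS](splitr e) lerD//.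
    have [_] := vP k; rewrite -ler_pdivlMl// => h; apply: le_trans h _.
    rewrite mulr1 -[leRHS]invrK lef_pV2 ?posrE ?invr_gt0 ?divr_gt0//.
    by rewrite invf_div (le_trans k0P)// ler_nat.
  exact: le_trans (NC _) (rP _ vl).
have l0 := norm_definite N_norm Nl0.
have [k _] := lP 1 ltr01 0%N.
by rewrite l0 subr0 (vP k).1 ltxx.
Qed.

End Norms.

(** * Sequences *)

Section Sequences.
Context {R : realType}.

Lemma cvg0_norm_lt d (v : nat -> 'cV[R]_d) :
  (v k @[k --> \oo] --> (0 : 'cV[R]_d)) <->
  (forall e, 0 < e -> \forall k \near \oo, `|v k| < e).
Proof.
split=> [/cvgrPdist_lt h e /h|h].
  by apply: filterS => k; rewrite sub0r normrN.
by apply/cvgrPdist_lt => e /h; apply: filterS => k; rewrite sub0r normrN.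
Qed.

Lemma bounded_near_everywhere d (v : nat -> 'cV[R]_d) C :
  (\forall k \near \oo, `|v k| <= C) -> exists M, forall k, `|v k| <= M.
Proof.
move=> [k0 _ vC]; exists (`|C| + \sum_(i < k0) `|v i|) => k.
have [kk|kk] := leqP k0 k.
  apply: le_trans (vC k kk) _; rewrite (le_trans (ler_norm _))// lerDl.
  exact: sumr_ge0.
by rewrite (bigD1 (Ordinal kk))//= addrCA lerDl addr_ge0// sumr_ge0.
Qed.

Lemma bounded_onP (I : Type) (V : normedModType R) (v : I -> V) (K : set I) :
  [bounded v k | k in K] -> exists M, forall k, K k -> `|v k| <= M.
Proof.
by move=> [M0 [_ h]]; exists (M0 + 1) => k Kk; apply: h; rewrite ?ltrDl.
Qed.

Lemma eventually_noninc (F : nat -> R) k0 :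
  (forall k, (k0 <= k)%N -> F k.+1 <= F k) ->
  forall i j, (k0 <= i)%N -> (i <= j)%N -> F j <= F i.
Proof.
move=> Fk i j ki /subnKC <-; elim: (j - i)%N => [|l IH]; first by rewrite addn0.
rewrite addnS; apply: le_trans IH; apply: Fk.
exact: leq_trans (leq_addr _ _).
Qed.

Lemma limn_einf_lt_frequently (u : nat -> R) a :
  (limn_einf (fun k => (u k)%:E) < a%:E)%E ->
  exists2 d, 0 < d & forall k0, exists2 k, (k0 <= k)%N & u k <= a - d.
Proof.
move=> ua; apply: contrapT => H.
suff : (a%:E <= limn_einf (fun k => (u k)%:E))%E by rewrite leNgt ua.
apply/lee_addgt0Pr => d d0.
rewrite -leeBlDr// -EFinB.
have [k0 k0P] : exists k0, forall k, (k0 <= k)%N -> a - d <= u k.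
  apply: contrapT => Hk; apply: H; exists d => // k0; apply: contrapT => Hk'.
  apply: Hk; exists k0 => k kk; rewrite leNgt; apply/negP => uk.
  by apply: Hk'; exists k => //; exact: ltW.
rewrite limn_einf_lim; apply: lime_ge; first exact: is_cvg_einfs.
exists k0 => // j /= jk; apply: le_ereal_inf_tmp => _ [i /= ji <-].
by rewrite lee_fin k0P// (leq_trans jk).
Qed.

End Sequences.

(** * Lagrangian bounds for the quadratic program *)

Section Quadratic.
Context {R : realType} {n m : nat}.
Variables (H : 'M[R]_n) (c : 'cV[R]_n) (A : 'M[R]_(m, n)) (b : 'cV[R]_m).
Hypothesis H_psd : sym_psd H.

Let P := CQP H c A b.
Let f := objective P.

Lemma dot_sym u v : dot u (H *m v) = dot v (H *m u).
Proof. by rewrite -dot_trmx H_psd.1 dotC. Qed.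

(** Second-order expansion of f at x, in which H x + c is split as the dual
residual plus A^T pi, and A y - A x is expressed by the slacks at (y,v) and
(x,z). *)
Lemma lagrangian_identity x z pi y v :
  f y + dot pi v =
  f x + dot (H *m x + c - A^T *m pi) (y - x)
    - dot pi (A *m x + z - b) + dot pi z
    + 2^-1 * dot (y - x) (H *m (y - x)) + dot pi (A *m y + v - b).
Proof.
rewrite /f /objective /= mulmxBr !dot_linear !dot_trmx !(dotC (H *m x)).
rewrite (dot_sym x y).
by field.
Qed.

Lemma lagrangian_bound x z pi y v : vle 0 pi -> vle b (A *m y + v) ->
  f x + dot (H *m x + c - A^T *m pi) (y - x)
    - dot pi (A *m x + z - b) + dot pi z <= f y + dot pi v.
Proof.
move=> pi0 byv.
rewrite (lagrangian_identity x z pi) -[leRHS]addrA lerDl addr_ge0//.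
  by rewrite mulr_ge0 ?invr_ge0//; exact: H_psd.2.
by apply: dot_ge0 => //; exact: vle_sub_ge0.
Qed.

Lemma objective_above_tangent x y : f x + dot (H *m x + c) (y - x) <= f y.
Proof.
have : 0 <= 2^-1 * dot (y - x) (H *m (y - x)).
  by rewrite mulr_ge0 ?invr_ge0//; exact: H_psd.2.
move=> quad0; rewrite -subr_ge0.
rewrite (_ : f y - _ = 2^-1 * dot (y - x) (H *m (y - x)))//.
rewrite /f /objective /= mulmxBr !dot_linear !(dotC (H *m x)) (dot_sym x y).
by field.
Qed.

(** The i-th entry of H u is the cross term e_i^T H u of the semidefinite form,
which is nonnegative at both e_i + u and e_i - u. *)
Lemma norm_mulmx_psd : exists2 C, 0 <= C &
  forall u, `|H *m u| <= C + 2^-1 * dot u (H *m u).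
Proof.
pose e i : 'cV[R]_n := delta_mx i 0.
exists (\sum_i 2^-1 * dot (e i) (H *m e i)).
  by apply: sumr_ge0 => i _; rewrite mulr_ge0 ?invr_ge0//; exact: H_psd.2.
move=> u; apply: cV_norm_le => [|i].
  rewrite addr_ge0// ?mulr_ge0 ?invr_ge0 ?H_psd.2//.
  by apply: sumr_ge0 => i _; rewrite mulr_ge0 ?invr_ge0//; exact: H_psd.2.
have -> : (H *m u) i 0 = dot (e i) (H *m u).
  rewrite dotE (bigD1 i)//= [e i i 0]mxE !eqxx mul1r big1 ?addr0// => j ji.
  by rewrite [e i j 0]mxE (negPf ji) mul0r.
apply: (@le_trans _ _ (2^-1 * dot (e i) (H *m e i) + 2^-1 * dot u (H *m u))).
  have := H_psd.2 (e i + u); have := H_psd.2 (e i - u).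
  rewrite mulmxBr mulmxDr !dot_linear (dot_sym u (e i)) ler_norml => h1 h2.
  by apply/andP; split; lra.
rewrite lerD2r (bigD1 i)//= lerDl.
by apply: sumr_ge0 => j _; rewrite mulr_ge0 ?invr_ge0//; exact: H_psd.2.
Qed.

Hypothesis assumptions : standing_assumptions H c A b.

(** Expanding f at the strictly feasible dual point (x0, p0), the level bound
controls both (x - x0)^T H (x - x0), hence H x, and p0^T sigma for the slack
sigma >= 0, hence A x because p0 > 0; a left inverse of [H;A] recovers x. *)
Lemma augmented_level_bounded D C : exists M, forall x z,
  `|z| <= D -> vle b (A *m x + z) -> f x <= C -> `|x| <= M.
Proof.
have [x0 [p0 [rp0 p0_gt0]]] := dual_strict assumptions.
have p0_ge0 : vle 0 p0 by move=> i; exact/ltW/p0_gt0.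
have [eps eps0 epsP] := vlt0_uniform p0_gt0.
have [C1 C1_ge0 C1P] := norm_mulmx_psd.
have [L LP] : exists L : 'M[R]_(n, n + m), L *m col_mx H A = 1%:M.
  exists (pinvmx (col_mx H A)); apply: mulVpmx.
  by rewrite /row_full (full_column_rank assumptions).
pose E := C + m%:R * `|p0| * D - f x0 + dot p0 (A *m x0 - b).
pose M1 := C1 + E + `|H *m x0|.
pose M2 := E / eps + D + `|b|.
exists ((n + m)%:R * `|L| * Num.max M1 M2) => x z zD bx fx.
have sigma_ge0 := vle_sub_ge0 bx.
have quad_ge0 : 0 <= 2^-1 * dot (x - x0) (H *m (x - x0)).
  by rewrite mulr_ge0 ?invr_ge0//; exact: H_psd.2.
have D0 : 0 <= D by exact: le_trans zD.
have pz : dot p0 z <= m%:R * `|p0| * D.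
  rewrite (le_trans (ler_norm _))// (le_trans (norm_dot _ _))//.
  by rewrite ler_wpM2l// mulr_ge0.
have p0sigma := dot_ge0 p0_ge0 sigma_ge0.
have /esym := lagrangian_identity x0 0 p0 x z.
rewrite rp0 addr0 {1 3}/dot trmx0 !(mul0mx, mulmx0) !mxE addr0 => key.
have quadE : 2^-1 * dot (x - x0) (H *m (x - x0)) <= E by rewrite /E; lra.
have sigmaE : dot p0 (A *m x + z - b) <= E by rewrite /E; lra.
have E0 : 0 <= E by exact: le_trans quadE.
have HxM : `|H *m x| <= M1.
  have -> : H *m x = H *m (x - x0) + H *m x0 by rewrite mulmxBr subrK.
  rewrite (le_trans (ler_normD _ _))// /M1 lerD2r (le_trans (C1P _))//.
  by rewrite lerD2l.
have sigma_le : `|A *m x + z - b| <= E / eps.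
  rewrite (le_trans (norm_le_sum sigma_ge0))// ler_pdivlMr// mulrC mulr_sumr.
  apply: le_trans sigmaE; rewrite dotE; apply: ler_sum => i _.
  by rewrite ler_wpM2r//; have := sigma_ge0 i; rewrite [X in X <= _]mxE.
have AxM : `|A *m x| <= M2.
  have -> : A *m x = (A *m x + z - b) - z + b by rewrite addrAC subrK addrK.
  rewrite (le_trans (ler_normD _ _))// lerD//.
  by rewrite (le_trans (ler_normB _ _))// lerD.
have -> : x = L *m (col_mx (H *m x) (A *m x)).
  by rewrite -mul_col_mx mulmxA LP mul1mx.
rewrite (le_trans (norm_mulmx _ _))// ler_wpM2l ?mulr_ge0//.
by apply: norm_col_mx_le; rewrite le_max ?HxM ?AxM ?orbT.
Qed.

End Quadratic.

(** * The augmented problem *)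

Section Augmented.
Context {R : realType} {n m : nat}.
Variables (H : 'M[R]_n) (c : 'cV[R]_n) (A : 'M[R]_(m, n)) (b : 'cV[R]_m).
Implicit Types (a : R) (x : 'cV[R]_n) (z pi xi : 'cV[R]_m).

Let P := CQP H c A b.

Lemma objective_augmented a x z :
  objective (augmented P a) (col_mx x z) = objective P x + a * \sum_i z i 0.
Proof.
rewrite /objective /= mul_block_col !mul0mx !addr0 /dot !tr_col_mx.
rewrite !mul_row_col mulmx0 addr0 [(c^T *m x + _) 0 0]mxE addrA; congr (_ + _).
rewrite -/(dot (const_mx a) z) dotE mulr_sumr.
by apply: eq_bigr => i _; rewrite mxE.
Qed.

Lemma vle_col_mx p q (u u' : 'cV[R]_p) (v v' : 'cV[R]_q) :
  vle (col_mx u v) (col_mx u' v') <-> vle u u' /\ vle v v'.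
Proof.
split=> [h|[hu hv] i].
  by split=> i; [have := h (lshift q i) | have := h (rshift p i)];
    rewrite ?col_mxEu ?col_mxEd.
by rewrite !mxE; case: splitP => j _; [exact: hu | exact: hv].
Qed.

Lemma vlt_col_mx p q (u u' : 'cV[R]_p) (v v' : 'cV[R]_q) :
  vlt (col_mx u v) (col_mx u' v') <-> vlt u u' /\ vlt v v'.
Proof.
split=> [h|[hu hv] i].
  by split=> i; [have := h (lshift q i) | have := h (rshift p i)];
    rewrite ?col_mxEu ?col_mxEd.
by rewrite !mxE; case: splitP => j _; [exact: hu | exact: hv].
Qed.

Lemma augmented_constraints a x z :
  cqpM (augmented P a) *m col_mx x z = col_mx (A *m x + z) z.
Proof. by rewrite /= mul_block_col !mul1mx mul0mx add0r. Qed.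

Lemma feasible_augmented a x z :
  feasible (augmented P a) (col_mx x z) <-> vle b (A *m x + z) /\ vle 0 z.
Proof. by rewrite /feasible augmented_constraints vle_col_mx. Qed.

Lemma strictly_feasible_augmented a x z :
  strictly_feasible (augmented P a) (col_mx x z) <->
  vlt b (A *m x + z) /\ vlt 0 z.
Proof. by rewrite /strictly_feasible augmented_constraints vlt_col_mx. Qed.

Lemma sym_psd_augmented a : sym_psd H -> sym_psd (cqpQ (augmented P a)).
Proof.
move=> [HT H0]; split=> [|u] /=; first by rewrite tr_block_mx HT !trmx0.
rewrite -[u]vsubmxK mul_block_col !mul0mx !addr0 /dot tr_col_mx mul_row_col.
by rewrite mulmx0 addr0; exact: H0.
Qed.

Lemma diagv_col_mx p q (u u' : 'cV[R]_p) (v v' : 'cV[R]_q) :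
  diagv (col_mx u v) *m col_mx u' v' = col_mx (diagv u *m u') (diagv v *m v').
Proof.
apply/colP => i; rewrite diagv_mulE !mxE.
by case: splitP => j _; rewrite diagv_mulE.
Qed.

Lemma kkt_residual_augmented (N : forall d, 'cV[R]_d -> R) a x z pi xi :
  kkt_residual N (augmented P a) (col_mx x z) (col_mx pi xi) =
  Num.max
    (N _ (col_mx (diagv (A *m x + z - b) *m pi) (diagv z *m xi)))
    (N _ (col_mx (H *m x + c - A^T *m pi) (const_mx a - (pi + xi)))).
Proof.
rewrite /kkt_residual augmented_constraints /= opp_col_mx add_col_mx subr0.
rewrite diagv_col_mx mul_block_col !mul0mx !addr0 add_col_mx add0r.
by rewrite tr_block_mx trmx0 !trmx1 mul_block_col mul0mx addr0 !mul1mx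
  opp_col_mx add_col_mx.
Qed.

End Augmented.

(** * Iterates of the master algorithm *)

Section Master.
Context {R : realType} {n m : nat}.
Variables (H : 'M[R]_n) (c : 'cV[R]_n) (A : 'M[R]_(m, n)) (b : 'cV[R]_m).
Hypothesis H_psd : sym_psd H.
Variables (N : forall d, 'cV[R]_d -> R) (B : base_iteration R).
Hypothesis B_req : base_iteration_requirements B N.
Variables (update : R -> 'cV[R]_n -> 'cV[R]_m -> 'cV[R]_m -> 'cV[R]_m -> R).
Variables (x : nat -> 'cV[R]_n) (z pi xi : nat -> 'cV[R]_m) (phi : nat -> R).
Variables (s : nat -> bi_state B (n + m) (m + m)) (t : nat -> nat).
Hypothesis master : master_iterations H c A b x z pi xi phi update s t.

Let P a := augmented (CQP H c A b) a.
Let w k := col_mx (x k) (z k).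

(** The properties of the base iteration are stated along runs from a proper
start, so every state must be located inside such a run. *)
Lemma state_in_run k : exists (s0 : bi_state B (n + m) (m + m)) l,
  proper_start (P (phi k.+1)) s0 /\ s k = bi_run (P (phi k.+1)) s0 l.
Proof.
have psd a : sym_psd (cqpQ (P a)) by exact: sym_psd_augmented.
elim: k => [|k [s0 [l [s0P skE]]]].
  by exists (s 0%N), 0%N; split=> //; split=> //; exact: master_first_run master.
have [same|new] := eqVneq (phi k.+2) (phi k.+1).
  exists s0, (t k + l)%N; rewrite same; split=> //.
  by rewrite (master_same_run master)// skE /bi_run iterD.
by exists (s k.+1), 0%N; split=> //; split=> //; exact: (master_new_run master).
Qed.

Lemma primal_seq_next k (s0 : bi_state B (n + m) (m + m)) l :
  s k = bi_run (P (phi k.+1)) s0 l ->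
  primal_seq (P (phi k.+1)) s0 l = w k /\
  primal_seq (P (phi k.+1)) s0 (t k + l) = w k.+1.
Proof.
move=> sk; rewrite /primal_seq -sk (master_state master); split=> //.
by rewrite [RHS](master_next_primal master k) /primal_seq sk /bi_run iterD.
Qed.

(** Feasibility and strict feasibility in the augmented problem do not involve
the penalty parameter, so they carry over from one run to the next. *)
Lemma iterates_feasible k : vle b (A *m x k + z k) /\ vle 0 (z k).
Proof.
have along (F : R -> 'cV[R]_(n + m) -> Prop) :
    (forall a a' u, F a u -> F a' u) ->
    (forall a (s0 : bi_state B (n + m) (m + m)),
       proper_start (P a) s0 -> forall l,
       F a (primal_seq (P a) s0 l) -> F a (primal_seq (P a) s0 l.+1)) ->
    F 0 (w 0%N) -> F 0 (w k).
  move=> Fa Fstep F0; elim: k => // k IH.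
  have [s0 [l [s0P /primal_seq_next[wk <-]]]] := state_in_run k.
  apply: (Fa (phi k.+1)); elim: (t k) => [|i IHi].
    by rewrite add0n wk; exact: Fa IH.
  by rewrite addSn; exact: Fstep.
have F1 : BI1i B -> vle 0 (z 0%N) -> vle b (A *m x 0%N + z 0%N) ->
    vle b (A *m x k + z k) /\ vle 0 (z k).
  move=> bi1 z0 b0; apply/(feasible_augmented H c A b 0).
  apply: (along (fun a u => feasible (P a) u)) => //.
  - by move=> a s0 s0P l; exact: bi1.
  - by apply/feasible_augmented.
have lt_le d (u v : 'cV[R]_d) : vlt u v -> vle u v by move=> uv i; exact/ltW/uv.
have [[z0 b0]|[bi1 z0 b0]] := master_start master; last exact: F1.
have [bi1|bi1] := bi_1 B_req; first by apply: F1 => //; exact: lt_le.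
suff [/lt_le bk /lt_le zk] : vlt b (A *m x k + z k) /\ vlt 0 (z k) by [].
apply/(strictly_feasible_augmented H c A b 0).
apply: (along (fun a u => strictly_feasible (P a) u)) => //.
- by move=> a s0 s0P l; exact: bi1.
- by apply/strictly_feasible_augmented.
Qed.

Lemma objective_decreases k :
  objective (CQP H c A b) (x k.+1) + phi k.+1 * \sum_i z k.+1 i 0 <=
  objective (CQP H c A b) (x k) + phi k.+1 * \sum_i z k i 0.
Proof.
rewrite -!objective_augmented; have := master_return master k.
by rewrite -(master_next_primal master).
Qed.

Lemma multipliers_ge0 k : vle 0 (pi k) /\ vle 0 (xi k).
Proof.
case: k => [|k]; first exact: master_dual_start master.
apply/vle_col_mx; rewrite col_mx0 (master_next_dual master).
have [s0 [l [s0P skE]]] := state_in_run k.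
have := bi_dual_ge0 B_req s0P (t k + l).
by rewrite /dual_seq /bi_run iterD skE.
Qed.

Section LastRun.
Variable a : R.
Hypothesis phi_const : \forall k \near \oo, phi k = a.

(** The last run starts where the penalty changes for the last time, or at 0. *)
Lemma last_run_start : exists k0,
  proper_start (P a) (s k0) /\ forall k, (k0 <= k)%N -> phi k.+1 = a.
Proof.
have psd : sym_psd (cqpQ (P a)) by exact: sym_psd_augmented.
have [k1 _ k1P] := phi_const.
have {k1P} : forall k, (k1 <= k)%N -> phi k.+1 = a.
  by move=> k kk; apply: k1P; exact: leq_trans kk _.
elim: k1 => [k1P|k1 IH k1P].
  by exists 0%N; split=> //; split=> //; rewrite -(k1P 0%N)//;
    exact: master_first_run master.
have [same|new] := eqVneq (phi k1.+1) a.
  by apply: IH => k; rewrite leq_eqVlt => /predU1P[<-//|]; exact: k1P.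
exists k1.+1; split=> //; split=> //.
have phiE := k1P k1.+1 (leqnn _); rewrite -phiE.
by apply: (master_new_run master); rewrite phiE eq_sym.
Qed.

(** After its start, the master algorithm keeps exactly the record points of the
last run: a returned point is no worse than its predecessor, and the points
skipped in between are strictly worse. So the asymptotic requirement on the base iteration,
which speaks of record indices, speaks of the iterates. *)
Lemma constant_penalty_residual M : (forall k, `|w k| <= M) ->
  forall e, 0 < e -> \forall k \near \oo,
    kkt_residual N (P a) (w k) (col_mx (pi k) (xi k)) < e.
Proof.
move=> wM e e0; have [k0 [s0P phiE]] := last_run_start.
(* iterate k0 + j is the point number T j of the run started at k0 *)
pose T j := (\sum_(i < j) t (k0 + i))%N.
have TS j : T j.+1 = (t (k0 + j) + T j)%N by rewrite /T big_ord_recr /= addnC.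
have sT j : s (k0 + j)%N = bi_run (P a) (s k0) (T j).
  elim: j => [|j IH]; first by rewrite addn0 /T big_ord0.
  rewrite addnS (master_same_run master); last first.
    by rewrite !phiE// ?leqW ?leq_addr.
  by rewrite phiE ?leq_addr// IH TS /bi_run iterD.
pose u := primal_seq (P a) (s k0); pose q l := objective (P a) (u l).
have uT j : u (T j) = w (k0 + j)%N.
  by rewrite /u /primal_seq -sT (master_state master).
have t0 k : (0 < t k)%N := master_count_gt0 master k.
have q_skip j l : (T j < l < T j.+1)%N -> q (T j) < q l.
  move=> /andP[jl lj].
  have l'P : (0 < l - T j < t (k0 + j))%N.
    by rewrite subn_gt0 jl ltn_subLR 1?addnC -?TS// ltnW.
  have := master_no_return master l'P.
  rewrite phiE ?leq_addr// -/(w _) -uT.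
  by rewrite /primal_seq sT /bi_run -iterD subnK// ltnW.
have q_step j : q (T j.+1) <= q (T j).
  have := master_return master (k0 + j).
  rewrite phiE ?leq_addr// -/(w _) -uT.
  by rewrite /primal_seq sT /bi_run -iterD -TS.
have q_record j : forall l, (l <= T j)%N -> q (T j) <= q l.
  elim: j => [|j IH] l.
    by rewrite {1}/T big_ord0 leqn0 => /eqP->; rewrite /T big_ord0.
  rewrite leq_eqVlt => /predU1P[->//|lj].
  have [/IH|jl] := leqP l (T j); first exact: le_trans.
  by apply: le_trans (q_step j) (ltW (q_skip j l _)); rewrite jl.
have T_ge j : (j <= T j)%N.
  elim: j => // j IH; rewrite TS; apply: leq_ltn_trans IH _.
  by rewrite -[X in (X < _)%N]add0n ltn_add2r.
have T_bracket j l : (l <= T j)%N -> l = 0%N \/ exists i, (T i < l <= T i.+1)%N.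
  elim: j l => [|j IH] l; first by rewrite {1}/T big_ord0 leqn0 => /eqP; left.
  have [/IH//|jl] := leqP l (T j).
  by move=> lj; right; exists j; rewrite jl.
pose K := record_indices (P a) u.
have K_T l : K l -> exists j, l = T j.
  move=> [l0 l_rec].
  have [l00|[i /andP[il]]] := T_bracket l l (T_ge l); first by rewrite l00 in l0.
  rewrite leq_eqVlt => /predU1P[->|li]; first by exists i.+1.
  have := l_rec _ il; rewrite -/(q _) -/(q l).
  by rewrite leNgt q_skip ?il.
have K_bounded : [bounded u k | k in K].
  exists M; split; first exact: num_real.
  by move=> y My _ /= /K_T[j ->]; rewrite uT; exact: le_trans (wM _) (ltW My).
have /cvgrPdist_lt/(_ e e0)[L _ LP] := bi_3 B_req s0P K_bounded.
exists (k0 + L).+1 => // k /= Lk.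
have kE : k = (k0 + (k - k0).-1.+1)%N by rewrite prednK ?subnKC//; lia.
set j := (k - k0).-1 in kE.
have KT : K (T j.+1).
  split=> [|l lj]; first by rewrite (leq_trans _ (T_ge _)).
  by apply: q_record; exact: ltnW.
have Lj : (L <= T j.+1)%N by apply: leq_trans (T_ge j.+1); rewrite /j; lia.
move: (LP _ Lj KT); rewrite /= sub0r normrN -/u; apply: le_lt_trans.
rewrite -/(u _) uT addnS -addnS -kE; apply: le_trans (ler_norm _) _.
rewrite [in col_mx (pi k)]kE [in col_mx _ (xi k)]kE addnS.
rewrite (master_next_dual master).
by rewrite phiE ?leq_addr// /dual_seq sT /bi_run -iterD -TS.
Qed.

End LastRun.

End Master.

(** * The penalty parameter stays bounded *)

Section UnboundedPenalty.
Context {R : realType} {n m : nat}.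
Variables (H : 'M[R]_n) (c : 'cV[R]_n) (A : 'M[R]_(m, n)) (b : 'cV[R]_m).
Hypothesis H_psd : sym_psd H.
Hypothesis assumptions : standing_assumptions H c A b.
Variables (x : nat -> 'cV[R]_n) (z pi : nat -> 'cV[R]_m) (phi : nat -> R).

Let f := objective (CQP H c A b).

(** The Lagrangian bound at a dual feasible point, with its multiplier replaced by
its max norm a. *)
Lemma dual_lower_bound : exists a C, 0 <= a /\ forall y v,
  vle 0 v -> vle b (A *m y + v) -> C <= f y + a * \sum_i v i 0.
Proof.
have [x0 [p0 [rp0 p0_gt0]]] := dual_strict assumptions.
have p0_ge0 : vle 0 p0 by move=> i; exact/ltW/p0_gt0.
exists `|p0|, (f x0 - dot p0 (A *m x0 - b)); split=> // y v v0 byv.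
have := lagrangian_bound c H_psd x0 0 p0_ge0 byv.
rewrite rp0 addr0 {1 3}/dot trmx0 !(mul0mx, mulmx0) !mxE !addr0 => h.
apply: le_trans h _; rewrite lerD2l dotE mulr_sumr; apply: ler_sum => i _.
apply: ler_wpM2r; first by have := v0 i; rewrite mxE.
exact: le_trans (ler_norm _) (coord_le_norm _ _ _).
Qed.

Hypothesis feas : forall k, vle b (A *m x k + z k) /\ vle 0 (z k).
Hypothesis pi_ge0 : forall k, vle 0 (pi k).

Let tau k := \sum_i z k i 0.

(** With C and a from [dual_lower_bound], g = f + a 1^T z - C is nonnegative and
g / (phi_k - a) + 1^T z is nonincreasing once phi_k > a, so any bound D of its
value at one such k bounds 1^T z from there on. The induction is on this
inequality multiplied by phi_k - a. *)
Lemma violations_bounded :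
  (forall k, phi k <= phi k.+1) ->
  (forall k, f (x k.+1) + phi k.+1 * tau k.+1 <= f (x k) + phi k.+1 * tau k) ->
  phi @ \oo --> +oo -> bounded_fun z.
Proof.
move=> phi_nd decr phi_oo.
have [a [C [a0 aC]]] := dual_lower_bound.
have g_ge0 k : 0 <= f (x k) + a * tau k - C.
  by rewrite subr_ge0; have [? ?] := feas k; exact: aC.
have [k1 _ k1P] : \forall k \near \oo, a + 1 <= phi k.
  by move/cvgryPge: phi_oo; exact.
(* as phi k1 - a >= 1, D dominates the quotient at k1 *)
pose D := f (x k1) + a * tau k1 - C + tau k1.
have main j : f (x (k1 + j)%N) + a * tau (k1 + j)%N - C +
    (phi (k1 + j)%N - a) * tau (k1 + j)%N <= D * (phi (k1 + j)%N - a) /\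
    tau (k1 + j)%N <= D.
  have tauD k : (k1 <= k)%N -> f (x k) + a * tau k - C +
      (phi k - a) * tau k <= D * (phi k - a) -> tau k <= D.
    move=> kk h; have phia : 0 < phi k - a by have := k1P k kk; rewrite /=; lra.
    rewrite -(ler_pM2r phia); have := g_ge0 k; lra.
  elim: j => [|j [IH IHtau]].
    rewrite addn0; have h : f (x k1) + a * tau k1 - C +
        (phi k1 - a) * tau k1 <= D * (phi k1 - a).
      have := k1P k1 (leqnn _); have := g_ge0 k1; rewrite /D /=; nra.
    by split=> //; exact: tauD h.
  rewrite addnS; set k := (k1 + j)%N in IH IHtau *.
  have h : f (x k.+1) + a * tau k.+1 - C +
      (phi k.+1 - a) * tau k.+1 <= D * (phi k.+1 - a).
    have := decr k; have := phi_nd k; nra.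
  by split=> //; apply: tauD h; rewrite /k; lia.
have [|M zM] := @bounded_near_everywhere _ _ z D.
  exists k1 => // k /= kk; apply: le_trans (norm_le_sum (feas k).2) _.
  by have := (main (k - k1)%N).2; rewrite subnKC.
exists M; split; first exact: num_real.
by move=> y My k _; exact: le_trans (zM k) (ltW My).
Qed.

(** A strictly feasible xs satisfies A xs - eta 1 >= b, so comparing x^k with
(xs, - eta 1) bounds eta 1^T pi^k along K, whereas phi_k / max(1, N pi^k) can
only stay bounded there if pi^k is unbounded. *)
Lemma penalty_not_diverging (xi : nat -> 'cV[R]_m)
    (N : forall d, 'cV[R]_d -> R) :
  is_norm N -> PU4 H c A b x z pi xi phi N ->
  bounded_fun z -> phi @ \oo --> +oo -> False.
Proof.
move=> N_norm pu4 z_bnd phi_oo.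
have [K [K_inf [[bs _ br] [_ brx bphi]]]] := pu4 z_bnd phi_oo.
have [Cs CsP] := bounded_onP bs.
have [Cr CrP] := bounded_onP br.
have [Cx CxP] := bounded_onP brx.
have [Cp CpP] := bounded_onP bphi.
have [Cz CzP] := bounded_onP z_bnd.
have [a [C [a0 aC]]] := dual_lower_bound.
have [xs xsP] := primal_strict assumptions.
have [eta eta0 etaP] : exists2 e, 0 < e & forall i, e <= (A *m xs - b) i 0.
  by apply: vlt0_uniform => i; rewrite mxE mxE [X in _ < _ + X]mxE subr_gt0.
have [CN CN0 CNP] := is_norm_le_max N_norm m.
have Cz0 : 0 <= Cz by exact: le_trans (CzP 0%N I).
have Az k : tau k <= m%:R * Cz.
  apply: le_trans (ler_norm _) _; rewrite (le_trans (norm_sum_coord _))//.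
  by rewrite ler_wpM2l// CzP.
pose E := f xs - C + a * (m%:R * Cz) + n%:R * Cr * `|xs| + Cx + m%:R * Cs.
have pi_bnd k : K k -> `|pi k| <= E / eta.
  move=> Kk.
  apply: le_trans (norm_le_sum (pi_ge0 k)) _; rewrite ler_pdivlMr//.
  have [fk zk] := feas k.
  have Axs : vle b (A *m xs + - const_mx eta).
    by move=> i; have := etaP i; rewrite !mxE; lra.
  have := lagrangian_bound c H_psd (x k) (z k) (pi_ge0 k) Axs.
  have piE : dot (pi k) (const_mx eta) = (\sum_i pi k i 0) * eta.
    by rewrite dotE mulr_suml; apply: eq_bigr => i _; rewrite mxE.
  rewrite dotNr piE dotDr dotNr.
  rewrite -/(dual_residual H c A x pi k) -/(slack A b x z k).
  have := dot_ge0 (pi_ge0 k) zk.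
  have := aC _ _ zk fk; rewrite -/(tau k) => h1.
  have h2 : dot (pi k) (slack A b x z k) <= m%:R * Cs.
    rewrite dot_diagv (le_trans (ler_norm _))// (le_trans (norm_sum_coord _))//.
    by rewrite ler_wpM2l// CsP.
  have h3 : `|dot (dual_residual H c A x pi k) xs| <= n%:R * Cr * `|xs|.
    by rewrite (le_trans (norm_dot _ _))// ler_wpM2r// ler_wpM2l// CrP.
  have h4 := CxP k Kk; move: h3 h4.
  rewrite !ler_norml => /andP[h3 _] /andP[_ h4].
  have h5 : a * tau k <= a * (m%:R * Cz) by rewrite ler_wpM2l.
  rewrite /E -/f; lra.
pose W := Num.max 1 (CN * (E / eta)).
have [k1 _ k1P] : \forall k \near \oo, `|Cp| * W + 1 <= phi k.
  by move/cvgryPge: phi_oo; exact.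
have [k [Kk kk1]] : exists k, K k /\ (k1 <= k)%N.
  apply: contrapT => nok; apply: K_inf.
  apply: (@sub_finite_set _ _ `I_k1) => [k Kk|]; last exact: finite_II.
  by rewrite /= ltnNge; apply/negP => kk; apply: nok; exists k.
have := CpP k Kk; rewrite leNgt => /negP; apply.
have phik := k1P k kk1; rewrite /= in phik.
have Mpos : 0 < Num.max 1 (N m (pi k)) by rewrite lt_max ltr01.
have W0 : 0 <= W by rewrite le_max ler01.
have MW : Num.max 1 (N m (pi k)) <= W.
  rewrite ge_max le_max lexx /= le_max; apply/orP; right.
  by apply: le_trans (CNP _) _; rewrite ler_wpM2l// pi_bnd.
apply: lt_le_trans (ler_norm _); rewrite ltr_pdivlMr//.
apply: (@le_lt_trans _ _ (`|Cp| * W)); last lra.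
apply: le_trans (ler_wpM2l _ MW); last exact: normr_ge0.
by rewrite ler_wpM2r// ?ler_norm// ltW.
Qed.

End UnboundedPenalty.

(** * Convergence under a constant penalty *)

Section ConstantPenalty.
Context {R : realType} {n m : nat}.
Variables (H : 'M[R]_n) (c : 'cV[R]_n) (A : 'M[R]_(m, n)) (b : 'cV[R]_m).
Hypothesis H_psd : sym_psd H.

Let P := CQP H c A b.
Let f := objective P.

(** Otherwise a subsequence stays away from the optimal set. A cluster point l of
it is feasible since z vanishes, and f(l) <= f(xs) since f lies above its
tangent at l: the subsequence comes close to an optimal point after all. *)
Lemma dist_optimal_cvg0 (N : forall d, 'cV[R]_d -> R) (x : nat -> 'cV[R]_n)
    (z : nat -> 'cV[R]_m) M xs :
  is_norm N -> (forall k, `|x k| <= M) ->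
  (forall k, vle b (A *m x k + z k)) ->
  z k @[k --> \oo] --> (0 : 'cV[R]_m) ->
  optimal_set P xs ->
  (forall e, 0 < e -> \forall k \near \oo, f (x k) <= f xs + e) ->
  dist N (x k) (optimal_set P) @[k --> \oo] --> (0 : R).
Proof.
move=> N_norm xM feas /cvg0_norm_lt z0 xs_opt fx.
have lbN u : has_lbound [set N n (u - v) | v in optimal_set P].
  by exists 0 => _ [v _ <-]; exact: is_norm_ge0.
have dist_ge0 u : 0 <= dist N u (optimal_set P).
  apply: lb_le_inf; first by exists (N n (u - xs)), xs.
  by move=> _ [v _ <-]; exact: is_norm_ge0.
have dist_le u v : optimal_set P v -> dist N u (optimal_set P) <= N n (u - v).
  by move=> vP; apply: ge_inf => //; exists v.
apply/cvgrPdist_lt => e e0; apply: contrapT => not_near.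
have far (k0 : nat) :
    exists k, (k0 <= k)%N /\ e <= dist N (x k) (optimal_set P).
  apply: contrapT => nok; apply: not_near; exists k0 => // k /= kk.
  rewrite sub0r normrN ger0_norm// ltNge; apply/negP => ek.
  by apply: nok; exists k.
have [g gP] := choice far.
have [l lP] := @bounded_cluster R n (x \o g) M (fun k => xM (g k)).
have freq d (F : set nat) : 0 < d -> (\forall k \near \oo, F k) ->
    exists k, [/\ F k, e <= dist N (x k) (optimal_set P) & `|x k - l| < d].
  move=> d0 [k0 _ k0P]; have [j jk xl] := lP d d0 k0.
  exists (g j); split=> //; last exact: (gP j).2.
  by apply: k0P; exact: leq_trans jk (gP j).1.
have l_feas : feasible P l.
  move=> i; apply/ler_addgt0Pr => d d0.
  have d2 : 0 < d / 2 by rewrite divr_gt0.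
  have [d' d'0 d'P] := small_multiple (mulr_ge0 (ler0n R n) (normr_ge0 A)) d2.
  have [k [zk _ xl]] := freq _ _ d'0 (z0 _ d2).
  have := feas k i; rewrite mxE.
  have := le_lt_trans (ler_norm _) (le_lt_trans (coord_le_norm (z k) i 0) zk).
  have : (A *m (x k - l)) i 0 <= d / 2.
    apply: le_trans (ler_norm _) _; apply: le_trans (coord_le_norm _ _ _) _.
    exact: le_trans (norm_mulmx _ _) (d'P _ xl).
  by rewrite mulmxBr mxE [(- (A *m l)) i 0]mxE /=; lra.
have fl : f l <= f xs.
  apply/ler_addgt0Pr => d d0.
  have d2 : 0 < d / 2 by rewrite divr_gt0.
  have [d' d'0 d'P] :=
    small_multiple (mulr_ge0 (ler0n R n) (normr_ge0 (H *m l + c))) d2.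
  have [k [fk _ xl]] := freq _ _ d'0 (fx _ d2).
  have := objective_above_tangent c A b H_psd l (x k).
  have : - (d / 2) <= dot (H *m l + c) (x k - l).
    suff : `|dot (H *m l + c) (x k - l)| <= d / 2.
      by rewrite ler_norml => /andP[].
    exact: le_trans (norm_dot _ _) (d'P _ xl).
  move: fk; rewrite -/P -/f; lra.
have l_opt : optimal_set P l.
  by split=> // v vP; apply: le_trans fl _; exact: xs_opt.2.
have [C C0 NC] := is_norm_le_max N_norm n.
have e2 : 0 < e / 2 by rewrite divr_gt0.
have [d d0 dP] := small_multiple C0 e2.
have [k [_ ek xl]] := freq _ setT d0 (@filterT _ _ _).
have := le_trans ek (le_trans (dist_le (x k) l l_opt) (NC _)).
by have := dP _ xl; lra.
Qed.

Variables (x : nat -> 'cV[R]_n) (z pi : nat -> 'cV[R]_m).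
Hypothesis feas : forall k, vle b (A *m x k + z k) /\ vle 0 (z k).
Hypothesis pi_ge0 : forall k, vle 0 (pi k).
Variables (a delta Mx : R).
Hypothesis x_bnd : forall k, `|x k| <= Mx.
Hypothesis delta_gt0 : 0 < delta.

Let F k := f (x k) + a * \sum_i z k i 0.

Hypothesis F_noninc : \forall k \near \oo, F k.+1 <= F k.
Hypothesis kkt_frequently : forall e, 0 < e -> forall k0, exists k,
  [/\ (k0 <= k)%N, `|pi k| <= a - delta, `|z k| <= e,
      `|dual_residual H c A x pi k| <= e &
      `|diagv (slack A b x z k) *m pi k| <= e].

(** An approximate exact-penalty inequality: since a - delta dominates pi^k, the
term pi^k^T v of the Lagrangian bound is absorbed by the penalty a 1^T v with
delta 1^T v to spare. *)
Lemma penalized_bound_frequently e : 0 < e ->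
  forall k0, exists2 k, (k0 <= k)%N &
  forall y v, `|y| <= Mx -> vle 0 v -> vle b (A *m y + v) ->
    F k + delta * \sum_i v i 0 <= f y + a * \sum_i v i 0 + e.
Proof.
move=> e0 k0.
have Mx0 : 0 <= Mx by exact: le_trans (x_bnd 0%N).
(* total weight of the terms pi^T s, r^T (y - x), a 1^T z in the bound, plus 1
   to keep it positive *)
pose C := m%:R + n%:R * (Mx + Mx) + `|a| * m%:R + 1.
have C0 : 0 < C by rewrite ltr_wpDl// !addr_ge0// !mulr_ge0// addr_ge0.
have [k [kk pik zk rk sk]] := kkt_frequently (divr_gt0 e0 C0) k0.
exists k => // y v yM v0 byv.
have := lagrangian_bound c H_psd (x k) (z k) (pi_ge0 k) byv.
rewrite -/(dual_residual H c A x pi k) -/(slack A b x z k) -/P -/f.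
set d := e / C in zk rk sk.
have d0 : 0 <= d by rewrite divr_ge0// ltW.
have eE : e = m%:R * d + n%:R * (Mx + Mx) * d + `|a| * m%:R * d + d.
  have -> : e = C * d by rewrite mulrC divfK// gt_eqF.
  by rewrite /C !mulrDl mul1r.
have h1 : dot (pi k) (slack A b x z k) <= m%:R * d.
  rewrite dot_diagv (le_trans (ler_norm _))// (le_trans (norm_sum_coord _))//.
  by rewrite ler_wpM2l.
have h2 : `|dot (dual_residual H c A x pi k) (y - x k)| <= n%:R * (Mx + Mx) * d.
  rewrite (le_trans (norm_dot _ _))// mulrAC ler_pM ?mulr_ge0//.
    by rewrite ler_wpM2l// (le_trans (ler_normB _ _))// lerD.
have h3 : 0 <= dot (pi k) (z k) by apply: dot_ge0 => //; exact: (feas k).2.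
have h4 : dot (pi k) v <= (a - delta) * \sum_i v i 0.
  rewrite dotE mulr_sumr; apply: ler_sum => i _.
  apply: ler_wpM2r; first by have := v0 i; rewrite mxE.
  exact: le_trans (ler_norm _) (le_trans (coord_le_norm _ _ _) pik).
have h5 : a * \sum_i z k i 0 <= `|a| * m%:R * d.
  rewrite (le_trans (ler_norm _))// normrM -mulrA ler_wpM2l//.
  by rewrite (le_trans (norm_sum_coord _))// ler_wpM2l.
move: h2; rewrite ler_norml => /andP[h2 _].
rewrite /F eE; lra.
Qed.

(** Once F is within eta of its infimum, the inequality above at (x^j, z^j)
leaves at most 2 eta for delta 1^T z^j. *)
Lemma violations_cvg0 : z k @[k --> \oo] --> (0 : 'cV[R]_m).
Proof.
have [k1 _ k1P] := F_noninc.
have F_nd := eventually_noninc k1P.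
have [k2 _ k2P] := penalized_bound_frequently ltr01 0%N.
pose S := [set F j | j in [set j | (k1 <= j)%N]].
have S_inf : has_inf S.
  split; first by exists (F k1), k1 => /=.
  exists (F k2 - 1) => _ [j _ <-].
  have [fj zj] := feas j; have := k2P _ _ (x_bnd j) zj fj.
  have := mulr_ge0 (ltW delta_gt0) (sum_vle0 zj).
  by rewrite /F; lra.
apply/cvg0_norm_lt => e e0.
pose eta := delta * (e / 2) / 2.
have eta0 : 0 < eta by rewrite /eta !divr_gt0// mulr_gt0// divr_gt0.
have [_ [J /= J1 <-] FJ] := inf_adherent eta0 S_inf.
exists J => // j /= Jj; have [fj zj] := feas j.
apply: (le_lt_trans (norm_le_sum zj)).
have [k kk kP] := penalized_bound_frequently eta0 k1.
have Fk : inf S <= F k by apply: ge_inf; [exact: S_inf.2 | exists k].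
have := kP _ _ (x_bnd j) zj fj; rewrite -/(F j).
move=> h; have FjJ := F_nd _ _ J1 Jj.
rewrite -(ltr_pM2l delta_gt0); apply: (@le_lt_trans _ _ (delta * (e / 2))).
  by move: h FJ; rewrite /eta; lra.
by rewrite ltr_pM2l// gtr_pMr// invf_lt1 ?ltr1n.
Qed.

Lemma objective_limsup_le xs e :
  0 <= a -> feasible P xs -> `|xs| <= Mx -> 0 < e ->
  \forall k \near \oo, f (x k) <= f xs + e.
Proof.
move=> a0 xs_feas xsM e0; have [k1 _ k1P] := F_noninc.
have [k kk kP] := penalized_bound_frequently e0 k1.
exists k => // j /= kj.
have Fjk : F j <= F k := eventually_noninc k1P kk kj.
have xs0 : vle b (A *m xs + 0) by rewrite addr0.
have := kP _ _ xsM (fun i => lexx _) xs0.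
rewrite !big1 ?mulr0; [|by move=> i _; rewrite mxE..].
have := mulr_ge0 a0 (sum_vle0 (feas j).2).
by move: Fjk; rewrite {1}/F; lra.
Qed.

End ConstantPenalty.

Lemma augmented_kkt_small (R : realType) (n m : nat)
    (H : 'M[R]_n) (c : 'cV[R]_n) (A : 'M[R]_(m, n)) (b : 'cV[R]_m)
    (N : forall d, 'cV[R]_d -> R) e : is_norm N -> 0 < e ->
  exists2 r, 0 < r & forall a x z pi xi,
    kkt_residual N (augmented (CQP H c A b) a) (col_mx x z) (col_mx pi xi) < r ->
    [/\ `|diagv (A *m x + z - b) *m pi| <= e, `|diagv z *m xi| <= e,
        `|H *m x + c - A^T *m pi| <= e & `|const_mx a - (pi + xi)| <= e].
Proof.
move=> N_norm e0.
have [C C0 CP] := max_le_is_norm N_norm (m + m).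
have [C' C'0 C'P] := max_le_is_norm N_norm (n + m).
have [r r0 rP] := small_multiple C0 e0.
have [r' r'0 r'P] := small_multiple C'0 e0.
exists (Num.min r r') => [|a x z pi xi]; first by rewrite lt_min r0.
rewrite kkt_residual_augmented gt_max !lt_min => /andP[/andP[Nr _] /andP[_ Nr']].
have h := le_trans (CP _) (rP _ Nr); have h' := le_trans (C'P _) (r'P _ Nr').
split.
- exact: le_trans (norm_usub_le _ _) h.
- exact: le_trans (norm_dsub_le _ _) h.
- exact: le_trans (norm_usub_le _ _) h'.
- exact: le_trans (norm_dsub_le _ _) h'.
Qed.

(** As pi + xi is within d / 2 of a 1 and pi <= a - d, necessarily xi >= d / 2, and
approximate complementarity of z and xi then bounds z. *)
Lemma violation_le (R : realType) (m : nat) (z pi xi : 'cV[R]_m) (a d e : R) :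
  vle 0 z -> 0 < d -> 0 <= e -> `|pi| <= a - d ->
  `|const_mx a - (pi + xi)| <= d / 2 -> `|diagv z *m xi| <= e * (d / 2) ->
  `|z| <= e.
Proof.
move=> z0 d0 e0 pia axi zxi; apply: cV_norm_le => // i.
have zi0 : 0 <= z i 0 by have := z0 i; rewrite mxE.
rewrite ger0_norm//.
have := le_trans (ler_norm _) (le_trans (coord_le_norm _ i 0) zxi).
have := le_trans (ler_norm _) (le_trans (coord_le_norm _ i 0) axi).
have := le_trans (ler_norm _) (le_trans (coord_le_norm _ i 0) pia).
rewrite diagv_mulE !mxE => h1 h2 h3.
have xid : d / 2 <= xi i 0 by lra.
have d2 : 0 < d / 2 by rewrite divr_gt0.
rewrite -(ler_pM2r d2); apply: le_trans h3.
by rewrite ler_wpM2l.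
Qed.

Section EventuallyConstant.
Context {R : realType} {n m : nat}.
Variables (H : 'M[R]_n) (c : 'cV[R]_n) (A : 'M[R]_(m, n)) (b : 'cV[R]_m).
Hypothesis H_psd : sym_psd H.
Hypothesis assumptions : standing_assumptions H c A b.
Variables (x : nat -> 'cV[R]_n) (z pi xi : nat -> 'cV[R]_m) (phi : nat -> R).
Variables (N : forall d, 'cV[R]_d -> R) (a : R).
Hypothesis N_norm : is_norm N.
Hypothesis feas : forall k, vle b (A *m x k + z k) /\ vle 0 (z k).
Hypothesis phi_const : \forall k \near \oo, phi k = a.
Hypothesis z_bnd : bounded_fun z.
Hypothesis a_ge0 : 0 <= a.

Let P := CQP H c A b.
Let f := objective P.
Let F k := f (x k) + a * \sum_i z k i 0.

Hypothesis F_noninc : \forall k \near \oo, F k.+1 <= F k.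

Lemma iterates_bounded : exists M, forall k, `|x k| <= M.
Proof.
have [k1 _ k1P] := F_noninc.
have [D DP] := bounded_onP z_bnd.
have [M MP] := augmented_level_bounded H_psd assumptions D (F k1).
apply: (@bounded_near_everywhere _ _ x M); exists k1 => // k /= kk.
apply: (MP (x k) (z k)); [exact: DP|exact: (feas k).1|].
have : F k <= F k1 := eventually_noninc k1P (leqnn _) kk.
apply: le_trans; rewrite lerDl mulr_ge0// sum_vle0//; exact: (feas k).2.
Qed.

Hypothesis pi_ge0 : forall k, vle 0 (pi k).
Hypothesis kkt_cvg0 : forall e, 0 < e -> \forall k \near \oo,
  kkt_residual N (augmented P a) (col_mx (x k) (z k)) (col_mx (pi k) (xi k)) < e.
Hypothesis pu3 : PU3 H c A b x z pi xi phi.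

(** The first four quantities that the update requirement wants to vanish are the
blocks of the augmented residual; the last one, r^T x, then vanishes because x
is bounded. *)
Lemma penalty_exceeds_multipliers : exists2 d, 0 < d &
  forall k0, exists2 k, (k0 <= k)%N & `|pi k| <= a - d.
Proof.
have small e : 0 < e -> \forall k \near \oo,
    [/\ `|diagv (slack A b x z k) *m pi k| <= e, `|diagv (z k) *m xi k| <= e,
        `|dual_residual H c A x pi k| <= e & `|const_mx a - (pi k + xi k)| <= e].
  move=> e0; have [r r0 rP] := augmented_kkt_small H c A b N_norm e0.
  by have := kkt_cvg0 r0; apply: filterS => k; exact: rP.
have [M xM] := iterates_bounded.
have half e : 0 < e -> e / 2 < e :> R.
  by move=> e0; rewrite gtr_pMr// invf_lt1 ?ltr1n.
apply: limn_einf_lt_frequently; apply: (pu3 phi_const).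
- apply/cvg0_norm_lt => e e0; have := small _ (divr_gt0 e0 (ltr0Sn R 1)).
  by apply: filterS => k [h _ _ _]; exact: le_lt_trans h (half e e0).
- apply/cvg0_norm_lt => e e0; have := small _ (divr_gt0 e0 (ltr0Sn R 1)).
  by apply: filterS => k [_ h _ _]; exact: le_lt_trans h (half e e0).
- apply/cvg0_norm_lt => e e0; have := small _ (divr_gt0 e0 (ltr0Sn R 1)).
  by apply: filterS => k [_ _ h _]; exact: le_lt_trans h (half e e0).
- apply/cvg0_norm_lt => e e0; have := small _ (divr_gt0 e0 (ltr0Sn R 1)).
  have := phi_const; apply: filterS2 => k -> [_ _ _ h].
  by rewrite -normrN opprB; exact: le_lt_trans h (half e e0).
- apply/cvgrPdist_lt => e e0.
  have M0 : 0 <= M by exact: le_trans (xM 0%N).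
  have e2 : 0 < e / 2 by rewrite divr_gt0.
  have [r r0 rP] := small_multiple (mulr_ge0 (ler0n R n) M0) e2.
  have := small _ (divr_gt0 r0 (ltr0Sn R 1)).
  apply: filterS => k [_ _ h _]; rewrite sub0r normrN.
  apply: le_lt_trans (half e e0); apply: le_trans (norm_dot _ _) _.
  apply: le_trans (rP _ (le_lt_trans h (half r r0))).
  by rewrite mulrAC ler_wpM2r// ler_wpM2l.
Qed.

Lemma constant_penalty_convergence :
  z k @[k --> \oo] --> (0 : 'cV[R]_m) /\
  dist N (x k) (optimal_set P) @[k --> \oo] --> (0 : R).
Proof.
have [d d0 dP] := penalty_exceeds_multipliers.
have [M0 xM0] := iterates_bounded.
have [xs xs_opt] := optimal_nonempty assumptions.
pose M := Num.max M0 `|xs|.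
have xM k : `|x k| <= M by rewrite le_max xM0.
have freq e : 0 < e -> forall k0, exists k,
  [/\ (k0 <= k)%N, `|pi k| <= a - d, `|z k| <= e,
      `|dual_residual H c A x pi k| <= e &
      `|diagv (slack A b x z k) *m pi k| <= e].
  move=> e0 k0; pose e1 := Num.min e (Num.min (d / 2) (e * (d / 2))).
  have e10 : 0 < e1.
    by rewrite /e1 !lt_min e0 divr_gt0//= mulr_gt0// divr_gt0.
  have [r r0 rP] := augmented_kkt_small H c A b N_norm e10.
  have [k1 _ k1P] := kkt_cvg0 r0.
  have [k kk pik] := dP (maxn k0 k1).
  have [|sk zk rk axi] := rP a (x k) (z k) (pi k) (xi k).
    by apply: k1P => /=; apply: leq_trans kk; exact: leq_maxr.
  have e1e : e1 <= e by rewrite ge_min lexx.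
  exists k; split=> //.
  - by apply: leq_trans kk; exact: leq_maxl.
  - apply: (@violation_le _ _ (z k) (pi k) (xi k) a d) => //.
    + exact: (feas k).2.
    + exact: ltW.
    + by apply: le_trans axi _; rewrite !ge_min lexx orbT.
    + by apply: le_trans zk _; rewrite !ge_min lexx !orbT.
  - exact: le_trans rk e1e.
  - exact: le_trans sk e1e.
have z0 := violations_cvg0 H_psd feas pi_ge0 xM d0 F_noninc freq.
split=> //; apply: (dist_optimal_cvg0 H_psd N_norm xM _ z0 xs_opt).
  by move=> k; exact: (feas k).1.
move=> e e0.
apply: (objective_limsup_le H_psd feas pi_ge0 xM F_noninc freq) => //.
  exact: xs_opt.1.
by rewrite le_max lexx orbT.
Qed.

End EventuallyConstant.

Theorem theorem3p7 (R : realType) (n m : nat) (n_gt0 : (0 < n)%N)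
    (m_gt0 : (0 < m)%N)
    (H : 'M[R]_n) (c : 'cV[R]_n) (A : 'M[R]_(m, n)) (b : 'cV[R]_m)
    (H_psd : sym_psd H)
    (assumptions : standing_assumptions H c A b)
    (N : forall d, 'cV[R]_d -> R) (N_norm : is_norm N)
    (B : base_iteration R) (B_req : base_iteration_requirements B N)
    (update : R -> 'cV[R]_n -> 'cV[R]_m -> 'cV[R]_m -> 'cV[R]_m -> R)
    (x : nat -> 'cV[R]_n) (z pi xi : nat -> 'cV[R]_m) (phi : nat -> R)
    (generated : generated_by_master H c A b x z pi xi phi B update)
    (update_req : penalty_update_requirements H c A b x z pi xi phi N) :
  eventually_constant phi /\
  (z k @[k --> \oo] --> (0 : 'cV[R]_m) /\
   dist N (x k) (optimal_set (CQP H c A b)) @[k --> \oo] --> (0 : R)).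
Proof.
have [s [t master]] := generated.
have [phi_gt0 phi_nd phi_dich] := pu_1 update_req.
have feas := iterates_feasible H_psd B_req master.
have mult := multipliers_ge0 H_psd B_req master.
have pi_ge0 k := (mult k).1.
have decr := objective_decreases master.
have not_div : ~ phi @ \oo --> +oo.
  move=> phi_oo.
  have z_bnd := violations_bounded H_psd assumptions feas phi_nd decr phi_oo.
  exact: (penalty_not_diverging H_psd assumptions feas pi_ge0 N_norm
            (pu_4 update_req) z_bnd phi_oo).
have [[a phi_const]|//] := phi_dich.
split; first by exists a.
have z_bnd : bounded_fun z.
  by apply: contrapT => /(pu_2 update_req).
have [k1 _ k1P] := phi_const.
have a0 : 0 <= a by rewrite -(k1P k1 (leqnn _)) ltW.
have F_noninc : \forall k \near \oo,
    objective (CQP H c A b) (x k.+1) + a * \sum_i z k.+1 i 0 <=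
    objective (CQP H c A b) (x k) + a * \sum_i z k i 0.
  exists k1 => // k /= kk; have := decr k.
  by rewrite (k1P k.+1)//= leqW.
have [Mx xM] := iterates_bounded H_psd assumptions feas z_bnd a0 F_noninc.
have [Mz zM] := bounded_onP z_bnd.
apply: (constant_penalty_convergence H_psd assumptions N_norm feas phi_const
          z_bnd a0 F_noninc pi_ge0 _ (pu_3 update_req)).
apply: (constant_penalty_residual H_psd B_req master phi_const) => k.
apply: (norm_col_mx_le (e := Num.max Mx Mz)); rewrite le_max ?xM//.
by rewrite zM// orbT.
Qed.
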